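(* Let $a\in(0,1/2]$. The function $f(x)=1/\mathcal{K}_a(1/\cosh(x))$ is increasing and concave from $(0,\infty)$ onto $(0,2/\pi)$. In particular, $$\frac{\mathcal{K}_a(r)\mathcal{K}_a(s)}{\mathcal{K}_a\left(\frac{rs}{1+r's'}\right)}\le \mathcal{K}_a(r)+\mathcal{K}_a(s)\le \frac{2\mathcal{K}_a(r)\mathcal{K}_a(s)}{\mathcal{K}_a\left(\sqrt{\frac{2rs}{1+rs+r's'}}\right)}\le \frac{2\mathcal{K}_a(r)\mathcal{K}_a(s)}{\mathcal{K}_a(\sqrt{rs})}$$ for all $r,s\in(0,1)$, where $r'=\sqrt{1-r^2}$ and $s'=\sqrt{1-s^2}$, with equality in the third inequality if and only if $r=s$.
   Context: $F(a,b;c;z)=\sum_{n=0}^\infty \frac{(a,n)(b,n)}{(c,n)}\frac{z^n}{n!}$ for $|z|<1$ is the Gaussian hypergeometric function, where $(a,0)=1$ and $(a,n)=a(a+1)\cdots(a+n-1)$ for $n\ge 1$. For $a\in(0,1/2]$ and $r\in(0,1)$, $\mathcal{K}_a(r)=\frac{\pi}{2}F(a,1-a;1;r^2)$. *)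

(* Defs.v *)
From Stdlib Require Import Reals Factorial.
From Coquelicot Require Import Coquelicot.
Open Scope R_scope.

(* The shifted factorial (a,n). *)
Fixpoint poch (a : R) (n : nat) : R :=
  match n with
  | O => 1
  | S m => poch a m * (a + INR m)
  end.

(* [PSeries] is total; the value is the sum of the series when |z| < 1. *)
Definition hyp2F1 (a b c z : R) : R :=
  PSeries (fun n => poch a n * poch b n / poch c n / INR (fact n)) z.

Definition ellK (a r : R) : R := PI / 2 * hyp2F1 a (1 - a) 1 (r ^ 2).

Definition strictly_increasing_on (D : R -> Prop) (f : R -> R) : Prop :=
  forall x y : R, D x -> D y -> x < y -> f x < f y.

(* Intended for convex D. *)
Definition concave_on (D : R -> Prop) (f : R -> R) : Prop :=
  forall x y t : R, D x -> D y -> 0 <= t <= 1 ->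
    t * f x + (1 - t) * f y <= f (t * x + (1 - t) * y).

Definition maps_onto (D E : R -> Prop) (f : R -> R) : Prop :=
  (forall x : R, D x -> E (f x)) /\
  (forall y : R, E y -> exists x : R, D x /\ f x = y).

(* Main.v *)
Require Import Defs.
From Stdlib Require Import Reals Factorial Lra Lia Ranalysis5.
From Coquelicot Require Import Coquelicot.
Open Scope R_scope.

(** Write [F(t) = F(a, 1 - a; 1; t)], [k = a (1 - a) <= 1/4], and let [G(t)] be
    the mean of [F] over the interval from [0] to [t]. The hypergeometric
    equation [(t (1 - t) F')' = k F] integrates to [(1 - t) F' = k G]
    ([is_derive_hyp]), and [1 <= G <= F] because [F] has nonnegative Taylor
    coefficients and [F(0) = 1].

    Put [t = sech(x)^2], so that [1 - t = tanh(x)^2]. The derivative of [1 / F]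
    with respect to [x] becomes [2 k (t G) / (tanh(x) F^2)]. It is positive, so
    [f] increases. Its numerator decreases in [x], since [t G] is the integral
    of [F] from [0] to [t] and [t] decreases ([sech_sq_hypMean_antitone]). Its
    denominator increases: the derivative is [t F (F - 4 k G)], which is
    nonnegative by [G <= F] and [4 k <= 1] ([tanh_hyp_sq_monotone]). Hence the
    derivative of [f] decreases and [f] is concave. The range of [f] follows
    from [F(0) = 1] and the bound [F(t) >= 1 - k ln (1 - t)], which comes from
    [F' >= k / (1 - t)].

    For the inequalities, write [r = sech x] and [s = sech y]; then
    [tanh x = r'], [tanh y = s'], and the addition formula gives
    [sech(x + y) = r s / (1 + r' s')]. A nonnegative concave function on the
    positive half-line is subadditive, which is the first inequality; the second
    is midpoint concavity at [x] and [y]. The third compares the arguments of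
    the increasing function [K]: they are ordered because
    [r s + r' s' <= 1], with equality only for [r = s]. *)

(** * Monotonicity and concavity from the derivative *)

Lemma is_derive_congr (f : R -> R) (x l l' : R) :
  is_derive f x l -> l = l' -> is_derive f x l'.
Proof. intros H <-. exact H. Qed.

Definition order_convex (D : R -> Prop) : Prop :=
  forall x y z : R, D x -> D y -> x <= z <= y -> D z.

Lemma mean_value_on (D : R -> Prop) (f df : R -> R) (x y : R) :
  order_convex D -> (forall z, D z -> is_derive f z (df z)) ->
  D x -> D y -> x <= y ->
  exists c, x <= c <= y /\ f y - f x = df c * (y - x).
Proof.
  intros HD Hf Dx Dy xy.
  destruct (MVT_gen f x y df) as [c [Hc E]].
  - rewrite Rmin_left, Rmax_right by lra. intros z Hz.
    apply Hf, (HD x y); auto; lra.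
  - rewrite Rmin_left, Rmax_right by lra. intros z Hz.
    apply derivable_continuous_pt. exists (df z). apply is_derive_Reals.
    apply Hf, (HD x y); auto; lra.
  - rewrite Rmin_left, Rmax_right in Hc by lra. exists c. auto.
Qed.

Lemma nondecreasing_of_derivative (D : R -> Prop) (f df : R -> R) :
  order_convex D -> (forall z, D z -> is_derive f z (df z)) ->
  (forall z, D z -> 0 <= df z) ->
  forall x y, D x -> D y -> x <= y -> f x <= f y.
Proof.
  intros HD Hf Hp x y Dx Dy xy.
  destruct (mean_value_on D f df x y) as [c [Hc E]]; auto.
  assert (0 <= df c) by (apply Hp, (HD x y); auto).
  assert (0 <= df c * (y - x)) by (apply Rmult_le_pos; lra). lra.
Qed.

Lemma increasing_of_derivative (D : R -> Prop) (f df : R -> R) :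
  order_convex D -> (forall z, D z -> is_derive f z (df z)) ->
  (forall z, D z -> 0 < df z) -> strictly_increasing_on D f.
Proof.
  intros HD Hf Hp x y Dx Dy xy.
  destruct (mean_value_on D f df x y) as [c [Hc E]]; auto; try lra.
  assert (0 < df c) by (apply Hp, (HD x y); auto).
  assert (0 < df c * (y - x)) by (apply Rmult_lt_0_compat; lra). lra.
Qed.

Lemma concave_of_antitone_derivative (D : R -> Prop) (f df : R -> R) :
  order_convex D -> (forall z, D z -> is_derive f z (df z)) ->
  (forall x y, D x -> D y -> x <= y -> df y <= df x) -> concave_on D f.
Proof.
  intros HD Hf Ha.
  assert (H : forall x y t, D x -> D y -> x <= y -> 0 <= t <= 1 ->
    t * f x + (1 - t) * f y <= f (t * x + (1 - t) * y)).
  { intros x y t Dx Dy xy Ht. set (z := t * x + (1 - t) * y).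
    assert (Ez1 : z - x = (1 - t) * (y - x)) by (unfold z; ring).
    assert (Ez2 : y - z = t * (y - x)) by (unfold z; ring).
    assert (0 <= (1 - t) * (y - x)) by (apply Rmult_le_pos; lra).
    assert (0 <= t * (y - x)) by (apply Rmult_le_pos; lra).
    assert (Dz : D z) by (apply (HD x y); auto; lra).
    destruct (mean_value_on D f df x z) as [c [Hc Ec]]; auto; try lra.
    destruct (mean_value_on D f df z y) as [d [Hd Ed]]; auto; try lra.
    assert (Hcd : df d <= df c).
    { apply Ha; [apply (HD x z) | apply (HD z y) | lra]; auto. }
    assert (0 <= t * (1 - t) * (y - x) * (df c - df d)).
    { repeat apply Rmult_le_pos; lra. }
    rewrite Ez1 in Ec. rewrite Ez2 in Ed.
    replace (f x) with (f z - df c * ((1 - t) * (y - x))) by lra.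
    replace (f y) with (f z + df d * (t * (y - x))) by lra. lra. }
  intros x y t Dx Dy Ht. destruct (Rle_dec x y) as [xy | xy].
  - apply H; auto.
  - specialize (H y x (1 - t) Dy Dx).
    replace (t * x + (1 - t) * y) with ((1 - t) * y + (1 - (1 - t)) * x) by ring.
    lra.
Qed.

(** For small [e > 0] the point [x] lies between [e] and [x + y], and dropping
    the value at [e] from the concavity inequality leaves
    [(x - e) f(x + y) <= (x + y - e) f(x)]; now let [e] tend to [0] and add the
    same inequality for [y]. *)
Lemma subadditive_of_concave (f : R -> R) :
  concave_on (fun x => 0 < x) f -> (forall x, 0 < x -> 0 <= f x) ->
  forall x y, 0 < x -> 0 < y -> f (x + y) <= f x + f y.
Proof.
  intros Hc Hp.
  assert (H : forall x y, 0 < x -> 0 < y -> x * f (x + y) <= (x + y) * f x).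
  { intros x y hx hy. apply Rnot_lt_le. intros L.
    assert (P1 := Hp (x + y) ltac:(lra)). assert (P2 := Hp x hx).
    set (d := x * f (x + y) - (x + y) * f x). assert (hd : 0 < d) by (unfold d; lra).
    (* The defect d is at most e (f(x + y) - f x) for every small e. *)
    set (e := Rmin (x / 2) (d / (2 * (f (x + y) + 1)))).
    assert (e1 : e <= x / 2) by apply Rmin_l.
    assert (e2 : e <= d / (2 * (f (x + y) + 1))) by apply Rmin_r.
    assert (e0 : 0 < e).
    { apply Rmin_glb_lt; [lra |]. apply Rdiv_lt_0_compat; lra. }
    assert (P3 := Hp e e0).
    assert (C := Hc (x + y) e ((x - e) / (x + y - e)) ltac:(lra) e0).
    replace ((x - e) / (x + y - e) * (x + y) + (1 - (x - e) / (x + y - e)) * e)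
      with x in C by (field; lra).
    assert (Hl : 0 <= (x - e) / (x + y - e) <= 1).
    { split; [apply Rdiv_le_0_compat; lra |].
      apply Rmult_le_reg_r with (x + y - e); [lra |].
      unfold Rdiv. rewrite Rmult_assoc, Rinv_l; lra. }
    specialize (C Hl).
    assert (0 <= (1 - (x - e) / (x + y - e)) * f e) by (apply Rmult_le_pos; lra).
    assert (C' : (x - e) * f (x + y) <= (x + y - e) * f x).
    { replace ((x - e) * f (x + y))
        with ((x + y - e) * ((x - e) / (x + y - e) * f (x + y))) by (field; lra).
      apply Rmult_le_compat_l; lra. }
    assert (e * f (x + y) <= d / 2).
    { apply Rle_trans with (d / (2 * (f (x + y) + 1)) * (f (x + y) + 1)).
      - apply Rmult_le_compat; lra.
      - right. field. lra. }
    assert (0 <= e * f x) by (apply Rmult_le_pos; lra).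
    unfold d in *. lra. }
  intros x y hx hy.
  assert (H1 := H x y hx hy). assert (H2 := H y x hy hx).
  rewrite (Rplus_comm y x) in H2.
  apply Rmult_le_reg_l with (x + y); lra.
Qed.

(** * Power series *)

Lemma lt_CV_radius_of_bounded (c : nat -> R) (x : R) :
  (forall n, Rabs (c n) <= 1) -> Rabs x < 1 -> Rbar_lt (Rabs x) (CV_radius c).
Proof.
  intros H hx. apply Rbar_lt_le_trans with 1; [exact hx |].
  apply (CV_radius_bounded c). exists 1. intros n.
  rewrite pow1, Rmult_1_r. apply H.
Qed.

Lemma PSeries_le (c d : nat -> R) (x : R) :
  (forall n, 0 <= c n <= d n) -> 0 <= x -> ex_pseries d x ->
  PSeries c x <= PSeries d x.
Proof.
  intros H hx E. apply Series_le.
  - intros n. assert (0 <= x ^ n) by (apply pow_le; lra).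
    specialize (H n). split; [apply Rmult_le_pos; lra |].
    apply Rmult_le_compat_r; lra.
  - apply ex_pseries_R, E.
Qed.

Lemma PSeries_ge_head (c : nat -> R) (x : R) :
  (forall n, 0 <= c n) -> 0 <= x -> ex_pseries c x -> c 0%nat <= PSeries c x.
Proof.
  intros H hx E.
  apply ex_pseries_R in E. unfold PSeries. rewrite Series_incr_1 by exact E.
  assert (0 <= Series (fun k => c (S k) * x ^ S k)).
  { rewrite <- (Rmult_0_l (Series (fun k => c (S k) * x ^ S k))), <- Series_scal_l.
    apply Series_le; [| apply (ex_series_incr_1 (fun k => c k * x ^ k)), E].
    intros n. rewrite Rmult_0_l.
    split; [lra | apply Rmult_le_pos; [apply H | apply pow_le, hx]]. }
  simpl pow at 1. lra.
Qed.

(** * The hypergeometric function with parameters [a], [1 - a], [1] *)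

Definition hypCoef (a : R) (n : nat) : R :=
  poch a n * poch (1 - a) n / poch 1 n / INR (fact n).

Definition hyp (a t : R) : R := PSeries (hypCoef a) t.

(** Termwise integration shows that this is the mean of [hyp a] over the
    interval from [0] to [t]. *)
Definition hypMean (a t : R) : R := PSeries (fun n => hypCoef a n / INR (S n)) t.

Lemma ellK_hyp (a r : R) : ellK a r = PI / 2 * hyp a (r ^ 2).
Proof. reflexivity. Qed.

Lemma poch_1 (n : nat) : poch 1 n = INR (fact n).
Proof.
  induction n as [| n IH]; [reflexivity |].
  change (fact (S n)) with (S n * fact n)%nat.
  rewrite mult_INR, <- IH. simpl poch. rewrite S_INR. ring.
Qed.

Lemma hypCoef_0 (a : R) : hypCoef a 0 = 1.
Proof. unfold hypCoef. simpl. field. Qed.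

Lemma hypCoef_S (a : R) (n : nat) :
  hypCoef a (S n) = hypCoef a n * ((a + INR n) * (1 - a + INR n) / INR (S n) ^ 2).
Proof.
  unfold hypCoef. rewrite !poch_1.
  change (fact (S n)) with (S n * fact n)%nat. rewrite mult_INR. simpl poch.
  assert (INR (fact n) <> 0) by apply INR_fact_neq_0.
  assert (INR (S n) <> 0) by (apply not_0_INR; lia).
  field. auto.
Qed.

Lemma hypCoef_bounds (a : R) : 0 < a < 1 -> forall n, 0 <= hypCoef a n <= 1.
Proof.
  intros ha n. induction n as [| n IH]; [rewrite hypCoef_0; lra |].
  assert (hn := pos_INR n).
  rewrite hypCoef_S, S_INR.
  assert (0 <= (a + INR n) * (1 - a + INR n) / (INR n + 1) ^ 2 <= 1).
  { split.
    - apply Rdiv_le_0_compat; [apply Rmult_le_pos; lra | apply pow_lt; lra].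
    - assert (0 < (INR n + 1) ^ 2) by (apply pow_lt; lra).
      apply Rmult_le_reg_r with ((INR n + 1) ^ 2); [lra |].
      unfold Rdiv. rewrite Rmult_assoc, Rinv_l by lra. nra. }
  split; [apply Rmult_le_pos; lra |].
  apply Rle_trans with (1 * 1); [apply Rmult_le_compat |]; lra.
Qed.

Lemma hypMeanCoef_bounds (a : R) : 0 < a < 1 ->
  forall n, 0 <= hypCoef a n / INR (S n) <= hypCoef a n.
Proof.
  intros ha n. assert (H := hypCoef_bounds a ha n).
  assert (hn := pos_INR n). rewrite S_INR. split.
  - apply Rdiv_le_0_compat; lra.
  - apply Rmult_le_reg_r with (INR n + 1); [lra |].
    unfold Rdiv. rewrite Rmult_assoc, Rinv_l by lra. nra.
Qed.

Lemma hypCoef_radius (a x : R) : 0 < a < 1 -> Rabs x < 1 ->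
  Rbar_lt (Rabs x) (CV_radius (hypCoef a)).
Proof.
  intros ha. apply lt_CV_radius_of_bounded. intros n.
  assert (H := hypCoef_bounds a ha n). rewrite Rabs_pos_eq; lra.
Qed.

Lemma hypMeanCoef_radius (a x : R) : 0 < a < 1 -> Rabs x < 1 ->
  Rbar_lt (Rabs x) (CV_radius (fun n => hypCoef a n / INR (S n))).
Proof.
  intros ha. apply lt_CV_radius_of_bounded. intros n.
  assert (H := hypCoef_bounds a ha n). assert (H' := hypMeanCoef_bounds a ha n).
  rewrite Rabs_pos_eq; lra.
Qed.

Lemma hypMean_ge_1 (a t : R) : 0 < a < 1 -> 0 <= t < 1 -> 1 <= hypMean a t.
Proof.
  intros ha ht.
  replace 1 with (hypCoef a 0 / INR 1) at 1 by (rewrite hypCoef_0; simpl; field).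
  apply (PSeries_ge_head (fun n => hypCoef a n / INR (S n))).
  - intros n. apply hypMeanCoef_bounds, ha.
  - lra.
  - apply CV_radius_inside, hypMeanCoef_radius; auto. rewrite Rabs_pos_eq; lra.
Qed.

Lemma hypMean_le_hyp (a t : R) : 0 < a < 1 -> 0 <= t < 1 -> hypMean a t <= hyp a t.
Proof.
  intros ha ht. apply PSeries_le.
  - intros n. apply hypMeanCoef_bounds, ha.
  - lra.
  - apply CV_radius_inside, hypCoef_radius; auto. rewrite Rabs_pos_eq; lra.
Qed.

Lemma hyp_ge_1 (a t : R) : 0 < a < 1 -> 0 <= t < 1 -> 1 <= hyp a t.
Proof.
  intros ha ht. assert (H := hypMean_ge_1 a t ha ht).
  assert (H' := hypMean_le_hyp a t ha ht). lra.
Qed.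

Lemma hyp_0 (a : R) : hyp a 0 = 1.
Proof. unfold hyp. rewrite PSeries_0. apply hypCoef_0. Qed.

Lemma is_derive_mul_hypMean (a t : R) : 0 < a < 1 -> Rabs t < 1 ->
  is_derive (fun u => u * hypMean a u) t (hyp a t).
Proof.
  intros ha ht.
  set (g := fun n => hypCoef a n / INR (S n)).
  apply is_derive_ext with (PSeries (PS_incr_1 g)).
  - intros u. apply PSeries_incr_1.
  - unfold hyp. rewrite (PSeries_ext (hypCoef a) (PS_derive (PS_incr_1 g))).
    + apply is_derive_PSeries. rewrite CV_radius_incr_1.
      apply hypMeanCoef_radius; auto.
    + intros n. unfold PS_derive, PS_incr_1, g.
      change (hypCoef a n = INR (S n) * (hypCoef a n / INR (S n))).
      field. apply not_0_INR. lia.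
Qed.

(** The integrated hypergeometric equation. With [k = a (1 - a)] the equation
    reads [(t (1 - t) F')' = k F], and [t] times the mean of [F] is the integral
    of [F] from [0], so [(1 - t) F' = k G]. On coefficients this is
    [(n + 1) c(n + 1) - n c(n) = k c(n) / (n + 1)]. *)
Lemma is_derive_hyp (a t : R) : 0 < a < 1 -> Rabs t < 1 ->
  is_derive (hyp a) t (a * (1 - a) * hypMean a t / (1 - t)).
Proof.
  intros ha ht.
  set (c := hypCoef a). set (d := PS_derive c).
  assert (Hd : ex_pseries d t).
  { apply ex_pseries_derive, hypCoef_radius; auto. }
  assert (E : PSeries d t - t * PSeries d t = a * (1 - a) * hypMean a t).
  { rewrite <- PSeries_incr_1, <- PSeries_minus; auto.
    2: { apply ex_pseries_incr_1, Hd. }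
    unfold hypMean. rewrite <- PSeries_scal. apply PSeries_ext.
    intros n.
    change (d n - PS_incr_1 d n = a * (1 - a) * (c n / INR (S n))).
    unfold d, PS_derive, c. rewrite hypCoef_S.
    assert (INR (S n) <> 0) by (apply not_0_INR; lia).
    destruct n as [| n].
    - change (INR 1 * (hypCoef a 0 * ((a + INR 0) * (1 - a + INR 0) / INR 1 ^ 2)) - 0
              = a * (1 - a) * (hypCoef a 0 / INR 1)).
      simpl. field.
    - change (PS_incr_1 (fun n0 => INR (S n0) * hypCoef a (S n0)) (S n))
        with (INR (S n) * hypCoef a (S n)).
      rewrite (S_INR (S n)) in *. field. auto. }
  assert (1 - t <> 0) by (apply Rabs_lt_between in ht; lra).
  replace (a * (1 - a) * hypMean a t / (1 - t)) with (PSeries d t).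
  - apply is_derive_PSeries, hypCoef_radius; auto.
  - rewrite <- E. field. auto.
Qed.

Lemma hyp_increasing (a : R) : 0 < a < 1 ->
  strictly_increasing_on (fun t => 0 <= t < 1) (hyp a).
Proof.
  intros ha.
  apply increasing_of_derivative with (fun t => a * (1 - a) * hypMean a t / (1 - t)).
  - intros x y z. lra.
  - intros t ht. apply is_derive_hyp; auto. rewrite Rabs_pos_eq; lra.
  - intros t ht. assert (H := hypMean_ge_1 a t ha ht).
    apply Rdiv_lt_0_compat; [| lra]. repeat apply Rmult_lt_0_compat; lra.
Qed.

(** Logarithmic divergence at [1]: the derivative of [hyp a] is at least
    [a (1 - a) / (1 - t)]. *)
Lemma hyp_ge_log (a t : R) : 0 < a < 1 -> 0 <= t < 1 ->
  1 - a * (1 - a) * ln (1 - t) <= hyp a t.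
Proof.
  intros ha ht.
  assert (H : hyp a 0 + a * (1 - a) * ln (1 - 0) <= hyp a t + a * (1 - a) * ln (1 - t)).
  { apply nondecreasing_of_derivative with (D := fun t => 0 <= t < 1)
      (f := fun t => hyp a t + a * (1 - a) * ln (1 - t))
      (df := fun t => a * (1 - a) * hypMean a t / (1 - t) + a * (1 - a) * (- / (1 - t)));
      try lra.
    - intros x y z. lra.
    - intros u hu. apply @is_derive_plus.
      + apply is_derive_hyp; auto. rewrite Rabs_pos_eq; lra.
      + auto_derive; [lra |]. field. lra.
    - intros u hu. assert (H := hypMean_ge_1 a u ha hu).
      replace (a * (1 - a) * hypMean a u / (1 - u) + a * (1 - a) * - / (1 - u))
        with (a * (1 - a) * (hypMean a u - 1) / (1 - u)) by (field; lra).
      apply Rdiv_le_0_compat; [| lra]. repeat apply Rmult_le_pos; lra. }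
  rewrite hyp_0, Rminus_0_r, ln_1 in H. lra.
Qed.

Lemma hyp_onto (a v : R) : 0 < a < 1 -> 1 < v -> exists t, 0 < t < 1 /\ hyp a t = v.
Proof.
  intros ha hv.
  assert (hk : 0 < a * (1 - a)) by (apply Rmult_lt_0_compat; lra).
  (* At this point the logarithmic lower bound is 1 + v. *)
  set (t1 := 1 - exp (- (v / (a * (1 - a))))).
  assert (hq : 0 < v / (a * (1 - a))) by (apply Rdiv_lt_0_compat; lra).
  assert (ht1 : 0 < t1 < 1).
  { assert (P := exp_pos (- (v / (a * (1 - a))))).
    assert (Q : exp (- (v / (a * (1 - a)))) < exp 0) by (apply exp_increasing; lra).
    rewrite exp_0 in Q. unfold t1. lra. }
  assert (H1 : 1 + v <= hyp a t1).
  { apply Rle_trans with (1 - a * (1 - a) * ln (1 - t1)).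
    - right. unfold t1. replace (1 - (1 - exp (- (v / (a * (1 - a))))))
        with (exp (- (v / (a * (1 - a))))) by ring.
      rewrite ln_exp. field. lra.
    - apply hyp_ge_log; auto. lra. }
  destruct (IVT_interv (fun t => hyp a t - v) 0 t1) as [t [ht E]].
  - intros t ht. apply derivable_continuous_pt.
    exists (a * (1 - a) * hypMean a t / (1 - t) - 0). apply is_derive_Reals.
    apply @is_derive_minus.
    + apply is_derive_hyp; auto. rewrite Rabs_pos_eq; lra.
    + apply @is_derive_const.
  - lra.
  - rewrite hyp_0. lra.
  - lra.
  - exists t. split; [| lra]. split; [| lra].
    destruct (Req_dec t 0) as [-> |]; [rewrite hyp_0 in E; lra | lra].
Qed.

(** * Hyperbolic functions *)

Lemma cosh_sinh_sq (x : R) : cosh x ^ 2 = 1 + sinh x ^ 2.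
Proof.
  unfold cosh, sinh.
  assert (E : exp x * exp (- x) = 1) by (rewrite <- exp_plus, Rplus_opp_r; apply exp_0).
  nra.
Qed.

Lemma cosh_pos (x : R) : 0 < cosh x.
Proof.
  unfold cosh. assert (H := exp_pos x). assert (H' := exp_pos (- x)). lra.
Qed.

Lemma sinh_pos (x : R) : 0 < x -> 0 < sinh x.
Proof.
  intros hx. unfold sinh.
  assert (exp (- x) < exp x) by (apply exp_increasing; lra). lra.
Qed.

Lemma cosh_plus (x y : R) : cosh (x + y) = cosh x * cosh y + sinh x * sinh y.
Proof.
  unfold cosh, sinh. rewrite Ropp_plus_distr, !exp_plus. field.
Qed.

Lemma sech_sq_bounds (x : R) : 0 < x -> 0 < (1 / cosh x) ^ 2 < 1.
Proof.
  intros hx. assert (C := cosh_pos x). assert (S := sinh_pos x hx).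
  assert (E := cosh_sinh_sq x).
  replace ((1 / cosh x) ^ 2) with (1 / cosh x ^ 2) by (field; lra).
  split; [apply Rdiv_lt_0_compat; nra |].
  apply Rmult_lt_reg_r with (cosh x ^ 2); [nra |].
  unfold Rdiv. rewrite Rmult_assoc, Rinv_l by nra. nra.
Qed.

Lemma is_derive_sech_sq (x : R) :
  is_derive (fun x => (1 / cosh x) ^ 2) x
    (- 2 * (1 / cosh x) ^ 2 * (sinh x / cosh x)).
Proof.
  assert (C := cosh_pos x).
  auto_derive; [lra |].
  field. lra.
Qed.

Lemma is_derive_tanh (x : R) :
  is_derive (fun x => sinh x / cosh x) x ((1 / cosh x) ^ 2).
Proof.
  assert (C := cosh_pos x). assert (E := cosh_sinh_sq x).
  replace ((1 / cosh x) ^ 2)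
    with ((cosh x * cosh x - sinh x * sinh x) / cosh x ^ 2).
  - apply is_derive_div; [| | lra]; apply is_derive_Reals.
    + apply derivable_pt_lim_sinh.
    + apply derivable_pt_lim_cosh.
  - replace (cosh x * cosh x - sinh x * sinh x) with 1 by nra. field. lra.
Qed.

(** The point is [x = ln ((1 + r') / r)], the positive solution of
    [cosh x = 1 / r]. *)
Lemma sech_onto (r : R) : 0 < r < 1 -> exists x, 0 < x /\ cosh x = 1 / r /\
  sinh x = sqrt (1 - r ^ 2) / r.
Proof.
  intros hr. set (q := sqrt (1 - r ^ 2)).
  assert (hq : 0 < q) by (apply sqrt_lt_R0; nra).
  assert (Eq : q * q = 1 - r ^ 2) by (apply sqrt_sqrt; nra).
  assert (h1 : 1 < (1 + q) / r).
  { apply Rmult_lt_reg_r with r; [lra |].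
    unfold Rdiv. rewrite Rmult_assoc, Rinv_l by lra. lra. }
  exists (ln ((1 + q) / r)).
  assert (E1 : exp (ln ((1 + q) / r)) = (1 + q) / r) by (apply exp_ln; lra).
  assert (E2 : exp (- ln ((1 + q) / r)) = (1 - q) / r).
  { rewrite exp_Ropp, E1.
    apply Rmult_eq_reg_r with ((1 + q) / r); [| lra].
    rewrite Rinv_l by lra.
    replace ((1 - q) / r * ((1 + q) / r)) with ((1 - q * q) / r ^ 2) by (field; lra).
    rewrite Eq. field. lra. }
  unfold cosh, sinh. rewrite E1, E2. repeat split.
  - rewrite <- ln_1. apply ln_increasing; lra.
  - field. lra.
  - field. lra.
Qed.

(** * The reciprocal in the hyperbolic variable *)

Lemma is_derive_hyp_sech (a x : R) : 0 < a < 1 -> 0 < x ->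
  is_derive (fun x => hyp a ((1 / cosh x) ^ 2)) x
    (- (2 * (a * (1 - a)) * ((1 / cosh x) ^ 2 * hypMean a ((1 / cosh x) ^ 2))
        / (sinh x / cosh x))).
Proof.
  intros ha hx. assert (B := sech_sq_bounds x hx).
  assert (C := cosh_pos x). assert (S := sinh_pos x hx).
  assert (E := cosh_sinh_sq x).
  assert (Ab : Rabs ((1 / cosh x) ^ 2) < 1) by (rewrite Rabs_pos_eq; lra).
  assert (H := is_derive_comp (hyp a) (fun x => (1 / cosh x) ^ 2) x _ _
    (is_derive_hyp a _ ha Ab) (is_derive_sech_sq x)).
  apply (is_derive_congr _ _ _ _ H).
  change scal with Rmult. cbv beta.
  set (G := hypMean a ((1 / cosh x) ^ 2)).
  replace (1 - (1 / cosh x) ^ 2) with ((sinh x / cosh x) ^ 2).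
  - field. lra.
  - replace ((sinh x / cosh x) ^ 2) with ((cosh x ^ 2 - 1) / cosh x ^ 2).
    + field. lra.
    + replace (cosh x ^ 2 - 1) with (sinh x ^ 2) by lra. field. lra.
Qed.

(** The function [t G(t)] has derivative [F(t) > 0], and [sech^2] decreases. *)
Lemma sech_sq_hypMean_antitone (a : R) : 0 < a < 1 -> forall x y, 0 < x -> x <= y ->
  (1 / cosh y) ^ 2 * hypMean a ((1 / cosh y) ^ 2)
  <= (1 / cosh x) ^ 2 * hypMean a ((1 / cosh x) ^ 2).
Proof.
  intros ha x y hx xy. apply Ropp_le_cancel.
  apply nondecreasing_of_derivative with (D := fun x => 0 < x)
    (f := fun x => - ((1 / cosh x) ^ 2 * hypMean a ((1 / cosh x) ^ 2)))
    (df := fun x => - (- 2 * (1 / cosh x) ^ 2 * (sinh x / cosh x)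
                       * hyp a ((1 / cosh x) ^ 2))); try lra.
  - intros u v w. lra.
  - intros z hz. assert (B := sech_sq_bounds z hz).
    apply @is_derive_opp.
    apply (is_derive_comp (fun u => u * hypMean a u) (fun x => (1 / cosh x) ^ 2) z).
    + apply is_derive_mul_hypMean; auto. rewrite Rabs_pos_eq; lra.
    + apply is_derive_sech_sq.
  - intros z hz. assert (B := sech_sq_bounds z hz).
    assert (C := cosh_pos z). assert (S := sinh_pos z hz).
    assert (H := hyp_ge_1 a ((1 / cosh z) ^ 2) ha ltac:(lra)).
    assert (0 < sinh z / cosh z) by (apply Rdiv_lt_0_compat; lra).
    assert (0 <= 2 * (1 / cosh z) ^ 2 * (sinh z / cosh z) * hyp a ((1 / cosh z) ^ 2)).
    { apply Rmult_le_pos; [| lra]. apply Rmult_le_pos; lra. }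
    lra.
Qed.

(** The derivative in [x] is [F (sech^2 F - 4 a (1 - a) sech^2 G)], with [F] and its
    mean [G] taken at [sech^2]. It is nonnegative since [G <= F] and
    [4 a (1 - a) <= 1]. *)
Lemma tanh_hyp_sq_monotone (a : R) : 0 < a < 1 -> forall x y, 0 < x -> x <= y ->
  sinh x / cosh x * hyp a ((1 / cosh x) ^ 2) ^ 2
  <= sinh y / cosh y * hyp a ((1 / cosh y) ^ 2) ^ 2.
Proof.
  intros ha x y hx xy.
  apply nondecreasing_of_derivative with (D := fun x => 0 < x)
    (f := fun x => sinh x / cosh x * hyp a ((1 / cosh x) ^ 2) ^ 2)
    (df := fun x => hyp a ((1 / cosh x) ^ 2) * ((1 / cosh x) ^ 2
      * (hyp a ((1 / cosh x) ^ 2) - 4 * (a * (1 - a)) * hypMean a ((1 / cosh x) ^ 2))));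
    try lra.
  - intros u v w. lra.
  - intros z hz. assert (C := cosh_pos z). assert (S := sinh_pos z hz).
    assert (H := is_derive_mult (fun x => sinh x / cosh x)
      (fun x => hyp a ((1 / cosh x) ^ 2) ^ 2) z _ _ (is_derive_tanh z)
      (is_derive_pow _ 2 z _ (is_derive_hyp_sech a z ha hz)) Rmult_comm).
    apply (is_derive_congr _ _ _ _ H).
    change plus with Rplus. change mult with Rmult. cbv beta.
    set (F := hyp a ((1 / cosh z) ^ 2)). set (G := hypMean a ((1 / cosh z) ^ 2)).
    simpl. field. lra.
  - intros z hz. assert (B := sech_sq_bounds z hz).
    assert (H := hypMean_ge_1 a ((1 / cosh z) ^ 2) ha ltac:(lra)).
    assert (H' := hypMean_le_hyp a ((1 / cosh z) ^ 2) ha ltac:(lra)).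
    assert (Hk : 4 * (a * (1 - a)) <= 1) by (assert (Q := pow2_ge_0 (1 - 2 * a)); lra).
    apply Rmult_le_compat_r with (r := hypMean a ((1 / cosh z) ^ 2)) in Hk; [| lra].
    apply Rmult_le_pos; [lra |]. apply Rmult_le_pos; lra.
Qed.

(** The derivative of [1 / K(sech x)], arranged as a decreasing function over an
    increasing one. *)
Definition dRecipK (a x : R) : R :=
  4 * (a * (1 - a)) / PI * ((1 / cosh x) ^ 2 * hypMean a ((1 / cosh x) ^ 2))
  / (sinh x / cosh x * hyp a ((1 / cosh x) ^ 2) ^ 2).

Lemma is_derive_recipK (a x : R) : 0 < a < 1 -> 0 < x ->
  is_derive (fun x => 1 / ellK a (1 / cosh x)) x (dRecipK a x).
Proof.
  intros ha hx. assert (B := sech_sq_bounds x hx).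
  assert (C := cosh_pos x). assert (S := sinh_pos x hx). assert (P := PI_RGT_0).
  assert (H := hyp_ge_1 a ((1 / cosh x) ^ 2) ha ltac:(lra)).
  apply is_derive_ext with (fun x => 2 / PI * / hyp a ((1 / cosh x) ^ 2)).
  - intros u. rewrite ellK_hyp. unfold Rdiv. rewrite !Rinv_mult, Rinv_inv.
    match goal with |- ?l = ?r => change (l = r :> R) end. ring.
  - assert (D := is_derive_scal _ x (2 / PI) _
      (is_derive_inv _ x _ (is_derive_hyp_sech a x ha hx) ltac:(lra))).
    apply (is_derive_congr _ _ _ _ D).
    unfold dRecipK. cbv beta.
    change opp with Ropp.
    field. lra.
Qed.

Lemma dRecipK_pos (a x : R) : 0 < a < 1 -> 0 < x -> 0 < dRecipK a x.
Proof.
  intros ha hx. assert (B := sech_sq_bounds x hx).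
  assert (C := cosh_pos x). assert (S := sinh_pos x hx). assert (P := PI_RGT_0).
  assert (H := hyp_ge_1 a ((1 / cosh x) ^ 2) ha ltac:(lra)).
  assert (H' := hypMean_ge_1 a ((1 / cosh x) ^ 2) ha ltac:(lra)).
  unfold dRecipK. apply Rdiv_lt_0_compat.
  - apply Rmult_lt_0_compat; [apply Rdiv_lt_0_compat; [| lra] |].
    + apply Rmult_lt_0_compat; [lra | apply Rmult_lt_0_compat; lra].
    + apply Rmult_lt_0_compat; lra.
  - apply Rmult_lt_0_compat; [apply Rdiv_lt_0_compat; lra | apply pow_lt; lra].
Qed.

Lemma dRecipK_antitone (a x y : R) : 0 < a < 1 -> 0 < x -> x <= y ->
  dRecipK a y <= dRecipK a x.
Proof.
  intros ha hx xy. assert (hy : 0 < y) by lra.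
  assert (P := PI_RGT_0).
  assert (M1 := sech_sq_hypMean_antitone a ha x y hx xy).
  assert (M2 := tanh_hyp_sq_monotone a ha x y hx xy).
  assert (By := sech_sq_bounds y hy). assert (Bx := sech_sq_bounds x hx).
  assert (0 < sinh x / cosh x * hyp a ((1 / cosh x) ^ 2) ^ 2).
  { assert (H := hyp_ge_1 a ((1 / cosh x) ^ 2) ha ltac:(lra)).
    apply Rmult_lt_0_compat; [| apply pow_lt; lra].
    apply Rdiv_lt_0_compat; [apply sinh_pos, hx | apply cosh_pos]. }
  assert (0 <= 4 * (a * (1 - a)) / PI).
  { apply Rdiv_le_0_compat; [| lra]. repeat apply Rmult_le_pos; lra. }
  assert (Hy := hypMean_ge_1 a ((1 / cosh y) ^ 2) ha ltac:(lra)).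
  unfold dRecipK. apply Rmult_le_compat.
  - apply Rmult_le_pos; [lra |]. apply Rmult_le_pos; lra.
  - apply Rlt_le, Rinv_0_lt_compat. lra.
  - apply Rmult_le_compat_l; lra.
  - apply Rinv_le_contravar; lra.
Qed.

Lemma recipK_increasing (a : R) : 0 < a < 1 ->
  strictly_increasing_on (fun x => 0 < x) (fun x => 1 / ellK a (1 / cosh x)).
Proof.
  intros ha. apply increasing_of_derivative with (dRecipK a).
  - intros u v w. lra.
  - intros x hx. apply is_derive_recipK; auto.
  - intros x hx. apply dRecipK_pos; auto.
Qed.

Lemma recipK_concave (a : R) : 0 < a < 1 ->
  concave_on (fun x => 0 < x) (fun x => 1 / ellK a (1 / cosh x)).
Proof.
  intros ha. apply concave_of_antitone_derivative with (dRecipK a).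
  - intros u v w. lra.
  - intros x hx. apply is_derive_recipK; auto.
  - intros x y hx hy. apply dRecipK_antitone; auto.
Qed.

Lemma ellK_gt (a r : R) : 0 < a < 1 -> 0 < r < 1 -> PI / 2 < ellK a r.
Proof.
  intros ha hr. assert (P := PI_RGT_0). rewrite ellK_hyp.
  rewrite <- (Rmult_1_r (PI / 2)) at 1. apply Rmult_lt_compat_l; [lra |].
  rewrite <- (hyp_0 a). apply hyp_increasing; auto; nra.
Qed.

Lemma ellK_pos (a r : R) : 0 < a < 1 -> 0 < r < 1 -> 0 < ellK a r.
Proof.
  intros ha hr. assert (P := PI_RGT_0). assert (H := ellK_gt a r ha hr). lra.
Qed.

Lemma ellK_increasing (a : R) : 0 < a < 1 ->
  strictly_increasing_on (fun r => 0 < r < 1) (ellK a).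
Proof.
  intros ha r s hr hs rs. rewrite !ellK_hyp. assert (P := PI_RGT_0).
  apply Rmult_lt_compat_l; [lra |]. apply hyp_increasing; auto; nra.
Qed.

Lemma sech_bounds (x : R) : 0 < x -> 0 < 1 / cosh x < 1.
Proof.
  intros hx. assert (B := sech_sq_bounds x hx).
  assert (0 < 1 / cosh x) by (apply Rdiv_lt_0_compat; [lra | apply cosh_pos]).
  nra.
Qed.

Lemma recipK_onto (a : R) : 0 < a < 1 ->
  maps_onto (fun x => 0 < x) (fun y => 0 < y < 2 / PI)
    (fun x => 1 / ellK a (1 / cosh x)).
Proof.
  intros ha. assert (P := PI_RGT_0). split.
  - intros x hx. assert (H := ellK_gt a _ ha (sech_bounds x hx)).
    split; [apply Rdiv_lt_0_compat; lra |].
    replace (2 / PI) with (1 / (PI / 2)) by (field; lra).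
    apply Rmult_lt_compat_l; [lra |]. apply Rinv_lt_contravar; [| lra].
    apply Rmult_lt_0_compat; lra.
  - intros y hy.
    destruct (hyp_onto a (2 / PI / y) ha) as [t [ht E]].
    { apply Rmult_lt_reg_r with y; [lra |].
      unfold Rdiv at 1. rewrite Rmult_assoc, Rinv_l; lra. }
    assert (St : sqrt t ^ 2 = t) by (rewrite <- Rsqr_pow2; apply Rsqr_sqrt; lra).
    assert (St0 : 0 < sqrt t) by (apply sqrt_lt_R0; lra).
    destruct (sech_onto (sqrt t)) as [x [hx [Cx _]]]; [nra |].
    exists x. split; [exact hx |]. rewrite Cx.
    replace (1 / (1 / sqrt t)) with (sqrt t) by (field; lra).
    rewrite ellK_hyp, St, E. field. lra.
Qed.

(** * The inequalities for the elliptic integral *)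

Lemma sq_complement_pos (r : R) : 0 < r < 1 ->
  0 < sqrt (1 - r ^ 2) /\ sqrt (1 - r ^ 2) ^ 2 = 1 - r ^ 2.
Proof.
  intros hr. split; [apply sqrt_lt_R0; nra |].
  rewrite <- Rsqr_pow2. apply Rsqr_sqrt. nra.
Qed.

(** Subadditivity of [1 / K(sech x)], multiplied by [K(r) K(s)]. *)
Lemma ellK_add_lower (a r s : R) : 0 < a < 1 -> 0 < r < 1 -> 0 < s < 1 ->
  ellK a r * ellK a s / ellK a (r * s / (1 + sqrt (1 - r ^ 2) * sqrt (1 - s ^ 2)))
  <= ellK a r + ellK a s.
Proof.
  intros ha hr hs.
  destruct (sech_onto r hr) as [x [hx [Cx Sx]]].
  destruct (sech_onto s hs) as [y [hy [Cy Sy]]].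
  destruct (sq_complement_pos r hr) as [Pr _]. destruct (sq_complement_pos s hs) as [Ps _].
  assert (H := subadditive_of_concave _ (recipK_concave a ha)
    (fun z hz => Rlt_le _ _ (proj1 (proj1 (recipK_onto a ha) z hz))) x y hx hy).
  cbv beta in H. rewrite cosh_plus, Cx, Cy, Sx, Sy in H.
  set (r' := sqrt (1 - r ^ 2)) in *. set (s' := sqrt (1 - s ^ 2)) in *.
  assert (0 < r' * s') by (apply Rmult_lt_0_compat; lra).
  replace (1 / (1 / r)) with r in H by (field; lra).
  replace (1 / (1 / s)) with s in H by (field; lra).
  replace (1 / (1 / r * (1 / s) + r' / r * (s' / s))) with (r * s / (1 + r' * s')) in H
    by (field; repeat split; lra).
  assert (Kr := ellK_pos a r ha hr). assert (Ks := ellK_pos a s ha hs).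
  replace (ellK a r + ellK a s)
    with (ellK a r * ellK a s * (1 / ellK a r + 1 / ellK a s)) by (field; lra).
  unfold Rdiv at 1. rewrite <- (Rmult_1_l (/ ellK a (r * s / _))).
  apply Rmult_le_compat_l; [apply Rmult_le_pos; lra | exact H].
Qed.

(** Midpoint concavity; the half-angle formula is
    [2 cosh((x + y)/2)^2 = 1 + cosh(x + y)]. *)
Lemma ellK_add_upper (a r s : R) : 0 < a < 1 -> 0 < r < 1 -> 0 < s < 1 ->
  ellK a r + ellK a s <= 2 * ellK a r * ellK a s /
    ellK a (sqrt (2 * r * s / (1 + r * s + sqrt (1 - r ^ 2) * sqrt (1 - s ^ 2)))).
Proof.
  intros ha hr hs.
  destruct (sech_onto r hr) as [x [hx [Cx Sx]]].
  destruct (sech_onto s hs) as [y [hy [Cy Sy]]].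
  destruct (sq_complement_pos r hr) as [Pr _]. destruct (sq_complement_pos s hs) as [Ps _].
  assert (H := recipK_concave a ha x y (1 / 2) hx hy ltac:(lra)).
  cbv beta in H.
  set (z := 1 / 2 * x + (1 - 1 / 2) * y) in *.
  assert (hz : 0 < z) by (unfold z; lra).
  assert (Ez : 2 * cosh z ^ 2 = 1 + cosh (x + y)).
  { replace (x + y) with (z + z) by (unfold z; field).
    rewrite cosh_plus. assert (E := cosh_sinh_sq z). lra. }
  rewrite cosh_plus, Cx, Cy, Sx, Sy in Ez. rewrite Cx, Cy in H.
  set (r' := sqrt (1 - r ^ 2)) in *. set (s' := sqrt (1 - s ^ 2)) in *.
  assert (0 < r' * s') by (apply Rmult_lt_0_compat; lra).
  assert (0 < r * s) by (apply Rmult_lt_0_compat; lra).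
  assert (Cz := cosh_pos z).
  assert (Q : sqrt (2 * r * s / (1 + r * s + r' * s')) = 1 / cosh z).
  { rewrite <- (sqrt_pow2 (1 / cosh z)) by (apply Rlt_le, sech_bounds, hz).
    f_equal. replace ((1 / cosh z) ^ 2) with (2 / (2 * cosh z ^ 2)) by (field; lra).
    rewrite Ez. field. repeat split; lra. }
  rewrite Q.
  replace (1 / (1 / r)) with r in H by (field; lra).
  replace (1 / (1 / s)) with s in H by (field; lra).
  assert (Kr := ellK_pos a r ha hr). assert (Ks := ellK_pos a s ha hs).
  replace (ellK a r + ellK a s) with
    (2 * ellK a r * ellK a s * (1 / 2 * (1 / ellK a r) + (1 - 1 / 2) * (1 / ellK a s)))
    by (field; lra).
  replace (2 * ellK a r * ellK a s / ellK a (1 / cosh z))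
    with (2 * ellK a r * ellK a s * (1 / ellK a (1 / cosh z))) by (unfold Rdiv; ring).
  apply Rmult_le_compat_l; [| exact H].
  apply Rmult_le_pos; [apply Rmult_le_pos |]; lra.
Qed.

(** Cauchy-Schwarz for the unit vectors [(r, r')] and [(s, s')]. *)
Lemma unit_dot_le_1 (r s : R) : 0 < r < 1 -> 0 < s < 1 ->
  r * s + sqrt (1 - r ^ 2) * sqrt (1 - s ^ 2) <= 1 /\
  (r * s + sqrt (1 - r ^ 2) * sqrt (1 - s ^ 2) = 1 <-> r = s).
Proof.
  intros hr hs.
  destruct (sq_complement_pos r hr) as [Pr Er]. destruct (sq_complement_pos s hs) as [Ps Es].
  assert (S1 := pow2_ge_0 (r - s)).
  assert (S2 := pow2_ge_0 (sqrt (1 - r ^ 2) - sqrt (1 - s ^ 2))).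
  split; [lra |]. split.
  - intros E. apply Rminus_diag_uniq, Rsqr_0_uniq. rewrite Rsqr_pow2. lra.
  - intros <-. lra.
Qed.

(** The square of [m] is [2 r s / (1 + (r s + r' s'))], and the
    bracket in the denominator is at most [1]. *)
Lemma geometric_mean_le (r s : R) : 0 < r < 1 -> 0 < s < 1 ->
  let m := sqrt (2 * r * s / (1 + r * s + sqrt (1 - r ^ 2) * sqrt (1 - s ^ 2))) in
  0 < sqrt (r * s) /\ m < 1 /\ sqrt (r * s) <= m /\ (sqrt (r * s) = m <-> r = s).
Proof.
  intros hr hs m.
  destruct (sq_complement_pos r hr) as [Pr _]. destruct (sq_complement_pos s hs) as [Ps _].
  destruct (unit_dot_le_1 r s hr hs) as [L LE]. unfold m.
  set (r' := sqrt (1 - r ^ 2)) in *. set (s' := sqrt (1 - s ^ 2)) in *. clear m.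
  set (A := 2 * r * s / (1 + r * s + r' * s')).
  assert (0 < r' * s') by (apply Rmult_lt_0_compat; lra).
  assert (0 < r * s < 1) by nra.
  assert (EA : A * (1 + r * s + r' * s') = 2 * (r * s)) by (unfold A; field; lra).
  assert (HA : r * s <= A) by nra.
  assert (HA1 : A < 1) by nra.
  repeat split.
  - apply sqrt_lt_R0. lra.
  - rewrite <- sqrt_1. apply sqrt_lt_1_alt. lra.
  - apply sqrt_le_1_alt, HA.
  - intros E. apply sqrt_inj in E; [| lra | lra]. apply LE.
    rewrite <- E in EA. apply Rmult_eq_reg_l with (r * s); lra.
  - intros E. f_equal. apply LE in E.
    replace (1 + r * s + r' * s') with 2 in EA by lra. lra.
Qed.

Theorem theorem1p8 : forall a : R, 0 < a <= 1 / 2 ->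
  let K := ellK a in
  let f := fun x : R => 1 / K (1 / cosh x) in
  let pos := fun x : R => 0 < x in
  (strictly_increasing_on pos f /\
   concave_on pos f /\
   maps_onto pos (fun y : R => 0 < y < 2 / PI) f) /\
  (forall r s : R, 0 < r < 1 -> 0 < s < 1 ->
   let r' := sqrt (1 - r ^ 2) in
   let s' := sqrt (1 - s ^ 2) in
   let M := 2 * K r * K s / K (sqrt (2 * r * s / (1 + r * s + r' * s'))) in
   let N := 2 * K r * K s / K (sqrt (r * s)) in
   K r * K s / K (r * s / (1 + r' * s')) <= K r + K s /\
   K r + K s <= M /\
   M <= N /\
   (M = N <-> r = s)).
Proof.
  intros a ha' K f pos. assert (ha : 0 < a < 1) by lra. split.
  { split; [| split].
    - apply recipK_increasing, ha.
    - apply recipK_concave, ha.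
    - apply recipK_onto, ha. }
  intros r s hr hs r' s' M N.
  split; [apply ellK_add_lower; auto |].
  split; [apply ellK_add_upper; auto |].
  destruct (geometric_mean_le r s hr hs) as [H0 [H1 [H2 H3]]].
  unfold M, N. fold r' s' in H1, H2, H3.
  set (m := sqrt (2 * r * s / (1 + r * s + r' * s'))) in *.
  set (g := sqrt (r * s)) in *.
  assert (Kg : 0 < K g) by (apply ellK_pos; auto; lra).
  assert (0 < 2 * K r * K s).
  { apply Rmult_lt_0_compat; [apply Rmult_lt_0_compat; [lra |] |];
      apply ellK_pos; auto. }
  destruct H2 as [H2 | H2].
  - assert (KL : K g < K m) by (apply ellK_increasing; auto; lra).
    assert (2 * K r * K s / K m < 2 * K r * K s / K g).
    { apply Rmult_lt_compat_l; [lra |]. apply Rinv_lt_contravar; [| lra].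
      apply Rmult_lt_0_compat; lra. }
    split; [lra |]. split; intros E; [lra |]. apply H3 in E. lra.
  - rewrite <- H2. split; [lra |]. split; [| reflexivity].
    intros _. apply H3, H2.
Qed.
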